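(* For every $k \geq 2$ and $n \geq 2$ we have $$N_k(2,n) = \rho_k(n)+1 .$$
   Context: The parameters $k,n$ are integers, and $[n]=\{1,\ldots,n\}$. Let $K^k_N$ denote the complete $k$-uniform hypergraph on the ordered vertex set $\{1,\ldots,N\}$, i.e. all $k$-element subsets of $\{1,\ldots,N\}$. For vertices $x_1<x_2<\cdots<x_{n+k-1}$, the $n$ edges $\{x_i,x_{i+1},\ldots,x_{i+k-1}\}$, $1\le i\le n$, form a monotone path of length $n$ (length is the number of edges). $N_k(2,n)$ is the smallest integer $N$ such that every coloring of the edges of $K^k_N$ with $2$ colors contains a monochromatic monotone path of length $n$ (all $n$ edges having the same color). Define $\mathcal{P}^k[n]$ for $k\ge 2$ inductively. Set $\mathcal{P}^2[n]=[n]^2$, and for $x=(x_1,x_2),x'=(x_1',x_2')\in[n]^2$ write $x'\subseteq x$ to mean $x_1'\le x_1$ and $x_2'\le x_2$. For $k\ge 3$, $\mathcal{P}^k[n]$ is the family of all down-sets in $\mathcal{P}^{k-1}[n]$: a set $\mathcal{F}\subseteq \mathcal{P}^{k-1}[n]$ (possibly empty) belongs to $\mathcal{P}^k[n]$ if and only if $S\in\mathcal{F}$ implies $S'\in\mathcal{F}$ for every $S'\in\mathcal{P}^{k-1}[n]$ with $S'\subseteq S$. Here, for members of $\mathcal{P}^{j}[n]$ with $j\ge 3$, $\subseteq$ is ordinary set inclusion. Finally, $\rho_k(n)=\lvert\mathcal{P}^k[n]\rvert$. *)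

(* Defs.v *)
From HB Require Import structures.
From mathcomp Require Import all_boot all_order.

Set Implicit Arguments.
Unset Strict Implicit.
Unset Printing Implicit Defensive.
Set Warnings "-redundant-canonical-projection,-projection-no-head-constant".

(* Products carry the componentwise order. *)
Import Order.DefaultProdOrder.

(* Vertices 1 < ... < N are represented by 'I_N, i.e. shifted down by 1. *)
Definition edge (k N : nat) : finType := {e : {set 'I_N} | #|e| == k}.

(* With x_1 < ... < x_(n+k-1) indexed from 0, the i-th edge (0 <= i < n) is
   {x_i, ..., x_(i+k-1)}; the length n is the number of edges. *)
Definition monotone_path (k N n : nat) (p : 'I_n -> edge k N) : Prop :=
  exists x : 'I_(n + k - 1) -> 'I_N,
    {homo x : i j / (i < j)%N} /\
    forall i : 'I_n,
      val (p i) = [set x j | j : 'I_(n + k - 1) & (i <= j < i + k)%N].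

Definition has_mono_path (q k n N : nat) : Prop :=
  forall c : edge k N -> 'I_q,
    exists p : 'I_n -> edge k N,
      monotone_path p /\ exists a : 'I_q, forall i : 'I_n, c (p i) = a.

(* N_k(q, n) = N.  The number is given by its graph, so that the definition
   does not presuppose that some N has the property. *)
Definition is_Nk (q k n N : nat) : Prop :=
  has_mono_path q k n N /\ forall M : nat, has_mono_path q k n M -> (N <= M)%N.

Definition is_downset d (T : finPOrderType d) (F : {set T}) : bool :=
  [forall S in F, forall S' : T, (S' <= S)%O ==> (S' \in F)].

Record downset d (T : finPOrderType d) : Type :=
  Downset { dset :> {set T}; _ : is_downset dset }.

Section DownsetOrder.
(* The subset order, in which down-sets are ordered by inclusion. *)
Import Order.DefaultSetSubsetOrder.
HB.instance Definition _ d (T : finPOrderType d) := [isSub for @dset d T].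
HB.instance Definition _ d (T : finPOrderType d) := [Finite of downset T by <:].
HB.instance Definition _ d (T : finPOrderType d) :=
  [SubChoice_isSubPOrder of downset T by <: with d].
End DownsetOrder.

Lemma le_downsetE d (T : finPOrderType d) (F G : downset T) :
  (F <= G)%O = (dset F \subset dset G).
Proof. by []. Qed.

(* P^k[n] for k >= 2 (for k < 2 the value is that of k = 2).  [n] is
   represented by 'I_n, i.e. shifted down by 1. *)
Definition PP (k n : nat) : finPOrderType _ :=
  iter (k - 2) (fun T => downset T : finPOrderType _) ('I_n * 'I_n)%type.

Definition rho (k n : nat) : nat := #|PP k n|.

(* Main.v *)
Require Import Defs.
From mathcomp Require Import all_boot all_order.
From mathcomp Require Import zify.

(** The proof translates colourings into labellings of shorter and shorter
    tuples of vertices, until only the vertices themselves carry labels.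

    Call a labelling f of the increasing (m+1)-tuples by elements of a finite
    poset P advancing if f (x_2, ..., x_(m+2)) <= f (x_1, ..., x_(m+1)) holds
    for no increasing (m+2)-tuple.  Three equivalences give the theorem.

    - A 2-colouring of the (m+2)-sets without a monochromatic monotone path of
      length n amounts to an advancing labelling of the (m+1)-tuples by [n]^2
      ([mono_path_or_advancing], [advancing_avoiding_coloring]).  From the
      colouring, label a tuple by the pair of lengths of the longest red and
      blue paths ending there: each further edge increases the coordinate of
      its colour.  From the labelling, colour an edge by a coordinate that
      increases along it: a monochromatic path of length n would give n+1
      increasing values in [n].

    - Advancing labellings of the (m+2)-tuples by P amount to advancing
      labellings of the (m+1)-tuples by the down-sets of P
      ([has_advancing_downset], [has_advancing_of_downset]).  From f, label v by
      the down-set generated by the labels of the tuples (x, v).  From F, label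
      (x, v) by an element of the down-set of v outside the one of its
      predecessor.  Iterating this k-2 times turns [n]^2 into P^k[n].

    - The vertices have an advancing labelling by P exactly when there are at
      most |P| of them ([has_advancing0]): such a labelling is injective, and
      conversely a linear extension of P is one. *)

Set Implicit Arguments.
Unset Strict Implicit.
Unset Printing Implicit Defensive.

Import Order.DefaultProdOrder Order.TTheory.

(** * Advancing labellings *)

Definition increasing N (s : seq 'I_N) : bool := sorted (relpre val ltn) s.

(** Labels are put on all sequences, but only increasing sequences of size
    m + 1 are constrained; x :: rcons t y is the increasing (m + 2)-tuple whose
    first and last m + 1 entries are compared. *)
Definition advancing N m d (P : finPOrderType d) (f : seq 'I_N -> P) : Prop :=
  forall x t y, size t = m -> increasing (x :: rcons t y) ->
    ~~ (f (rcons t y) <= f (x :: t))%O.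

Definition has_advancing N m d (P : finPOrderType d) : Prop :=
  exists f : seq 'I_N -> P, advancing m f.

(** * From labels to down-sets of labels *)

Lemma downset_closed d (P : finPOrderType d) (F : downset P) p q :
  p \in dset F -> (q <= p)%O -> q \in dset F.
Proof.
case: F => F /= downF pF le_qp.
by move/forall_inP: downF => /(_ p pF)/forallP/(_ q)/implyP; apply.
Qed.

Lemma is_downset0 d (P : finPOrderType d) : is_downset (set0 : {set P}).
Proof. by apply/forall_inP => p; rewrite inE. Qed.

Section DownsetStep.
Variables (N m : nat) (d : Order.disp_t) (P : finPOrderType d).

(** The down-set generated by the labels of the tuples that extend v by one
    vertex on the left. *)
Definition in_labels (f : seq 'I_N -> P) (v : seq 'I_N) : {set P} :=
  [set p | [exists x, increasing (x :: v) && (p <= f (x :: v))%O]].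

Lemma in_labels_downset f v : is_downset (in_labels f v).
Proof.
apply/forall_inP => p; rewrite inE => /existsP[x /andP[incx le_px]].
apply/forallP => q; apply/implyP => le_qp; rewrite inE.
by apply/existsP; exists x; rewrite incx (le_trans le_qp).
Qed.

(** The label of x :: rcons t y separates the down-sets of its two ends: it is
    one of the labels entering rcons t y, while lying below a label entering
    x :: t would contradict that f is advancing. *)
Lemma has_advancing_downset :
  has_advancing N m.+1 P -> has_advancing N m (downset P).
Proof.
case=> f advf; exists (fun v => Downset (in_labels_downset f v)).
move=> x t y size_t inc; rewrite le_downsetE; apply/subsetPn => /=.
exists (f (x :: rcons t y)).
  by rewrite inE; apply/existsP; exists x; rewrite inc lexx.
rewrite inE; apply/existsP => -[z /andP[inc_zxt le_f]].
have inc_all : increasing (z :: rcons (x :: t) y).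
  by move: inc_zxt inc; rewrite /increasing /= => /andP[-> _] ->.
by have := advf z (x :: t) y (congr1 S size_t) inc_all; rewrite rcons_cons le_f.
Qed.

(** Non-inclusion provides, for each tuple, a label in the down-set of its end
    and outside the down-set of its start.  Along two consecutive tuples, the
    first label lies in the middle down-set and the second does not. *)
Lemma has_advancing_of_downset (p0 : P) :
  has_advancing N m (downset P) -> has_advancing N m.+1 P.
Proof.
case=> F advF.
pose f s := if s is x :: v then
  odflt p0 [pick p in dset (F v) :\: dset (F (belast x v))] else p0.
have fP x t y : size t = m -> increasing (x :: rcons t y) ->
    f (x :: rcons t y) \in dset (F (rcons t y)) :\: dset (F (x :: t)).
  move=> size_t inc; rewrite /f belast_rcons; case: pickP => //= no_p.
  have := advF x t y size_t inc; rewrite le_downsetE => /subsetPn[p pv pu].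
  by have := no_p p; rewrite !inE pv pu.
have f_in x v : size v = m.+1 -> increasing (x :: v) ->
    f (x :: v) \in dset (F v).
  case/lastP: v => [//|t y]; rewrite size_rcons => -[size_t] inc.
  by have := fP x t y size_t inc; rewrite inE => /andP[].
exists f => x [//|x1 t] y [size_t] inc.
have inc1 : increasing (x1 :: rcons t y) by exact: path_sorted inc.
have inc2 : increasing (x :: x1 :: t).
  by move: inc; rewrite /increasing /= rcons_path => /and3P[-> ->].
have := fP x1 t y size_t inc1; rewrite inE => /andP[notin _].
have in_t := f_in x (x1 :: t) (congr1 S size_t) inc2.
by apply: contra notin => le_f; apply: downset_closed in_t le_f.
Qed.

End DownsetStep.

(** Each step shortens the labelled tuples by one vertex.  An element of P is
    needed as a default label when going back to longer tuples. *)
Lemma has_advancing_iter N m d (P : finPOrderType d) (p0 : P) :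
  has_advancing N m P <->
  has_advancing N 0 (iter m (fun T => downset T : finPOrderType d) P).
Proof.
elim: m => [|m IHm] in P p0 *; first by [].
rewrite iterSr; apply: iff_trans (IHm _ (Downset (is_downset0 P))).
split; first exact: has_advancing_downset.
exact: has_advancing_of_downset.
Qed.

Lemma iter_downset_inhabited m d (P : finPOrderType d) (p0 : P) :
  iter m (fun T => downset T : finPOrderType d) P.
Proof. by case: m => [|m]; [exact: p0 | exact: Downset (is_downset0 _)]. Qed.

(** * Labelling single vertices *)

Section LinearExtension.
Variables (d : Order.disp_t) (P : finPOrderType d).

Let height (p : P) := #|[pred q | (q <= p)%O]|.

Lemma height_lt p q : (p < q)%O -> (height p < height q)%N.
Proof.
move=> lt_pq; apply/proper_card/properP; split.
  by apply/subsetP => r; rewrite !inE => /le_trans; apply; apply: ltW.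
by exists q; rewrite !inE ?lexx // lt_geF.
Qed.

(** Listing P by the size of principal down-sets is a linear extension, so no
    element is followed by one below it. *)
Lemma has_advancing0 N (p0 : P) : has_advancing N 0 P <-> (N <= #|P|)%N.
Proof.
split=> [[f advf]|le_N].
  rewrite -[N]card_ord; apply: (@leq_card _ _ (fun i : 'I_N => f [:: i])).
  have neq_lt (i j : 'I_N) : (i < j)%N -> f [:: i] != f [:: j].
    move=> lt_ij; have := advf i [::] j erefl; rewrite /increasing /= lt_ij.
    by move=> /(_ isT); apply: contra => /eqP->.
  move=> i j eq_f; apply: val_inj; case: (ltngtP (val i) (val j)) => // lt_ij.
    by have := neq_lt i j lt_ij; rewrite eq_f eqxx.
  by have := neq_lt j i lt_ij; rewrite eq_f eqxx.
pose leh := relpre height leq; pose s := sort leh (enum P).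
have size_s : size s = #|P| by rewrite size_sort -cardE.
have sorted_s : sorted leh s by apply: sort_sorted => p q; apply: leq_total.
exists (fun v : seq 'I_N => if v is i :: _ then nth p0 s i else p0).
move=> i [] // j _; rewrite /increasing /= andbT => lt_ij.
have [lt_i lt_j] : (i < size s)%N /\ (j < size s)%N.
  by rewrite size_s; split; apply: leq_trans (ltn_ord _) le_N.
have leh_trans : transitive leh by move=> p q r; apply: leq_trans.
have le_h : (height (nth p0 s i) <= height (nth p0 s j))%N.
  by apply: (sorted_ltn_nth leh_trans p0 sorted_s).
apply/negP; rewrite le_eqVlt => /orP[|/height_lt]; last by rewrite ltnNge le_h.
by rewrite nth_uniq ?sort_uniq ?enum_uniq // gtn_eqF.
Qed.

End LinearExtension.

(** * Edges, windows and paths *)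

Section Windows.
Variable N : nat.
Implicit Types s v W : seq 'I_N.

Let lt_trans_N : transitive (relpre (@nat_of_ord N) ltn).
Proof. by move=> x y z; apply: ltn_trans. Qed.

Lemma increasing_uniq s : increasing s -> uniq s.
Proof. by apply: sorted_uniq => // x; rewrite /= ltnn. Qed.

Lemma enum_increasing (A : {set 'I_N}) : increasing (enum A).
Proof.
rewrite /increasing {1}/enum_mem -enumT; apply: sorted_filter => //.
by rewrite -sorted_map val_enum_ord iota_ltn_sorted.
Qed.

Lemma enum_set_increasing s : increasing s -> enum [set x in s] = s.
Proof.
move=> inc; apply: (irr_sorted_eq lt_trans_N) => //.
- by move=> x; rewrite /= ltnn.
- exact: enum_increasing.
- by move=> x; rewrite mem_enum inE.
Qed.

Definition window k i W := take k (drop i W).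

Lemma window_increasing k i W : increasing W -> increasing (window k i W).
Proof. by move=> incW; apply/take_sorted/drop_sorted. Qed.

Lemma size_window k i W : (i + k <= size W)%N -> size (window k i W) = k.
Proof. by move=> le_ik; rewrite size_takel // size_drop; lia. Qed.

Lemma window_catl k i W W' :
  (i + k <= size W)%N -> window k i (W ++ W') = window k i W.
Proof.
move=> le_ik; rewrite /window drop_cat; case: ltnP => [lt_i|ge_i].
  by rewrite takel_cat // size_drop; lia.
have -> : k = 0 by lia.
by rewrite !take0.
Qed.

(** Links the edges of a monotone path, given as sets of vertices, to the
    consecutive blocks of its vertex sequence. *)
Lemma window_codom L (x : 'I_L -> 'I_N) k i :
  [set x j | j : 'I_L & (i <= j < i + k)%N] = [set y in window k i (codom x)].
Proof.
have mem_w (j : 'I_L) :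
    (j \in take k (drop i (enum 'I_L))) = (i <= j < i + k)%N.
  rewrite -(mem_map val_inj) map_take map_drop val_enum_ord drop_iota take_iota.
  by rewrite mem_iota /=; have := ltn_ord j; lia.
apply/setP => y; rewrite inE /window /codom /image_mem -map_drop -map_take.
apply/imsetP/mapP => -[j].
  by rewrite inE -mem_w => jw ->; exists j.
by rewrite mem_w => jw ->; exists j; rewrite // inE.
Qed.

End Windows.

(** Consecutive (m+1)-windows are the two ends of an (m+2)-window, in the shape
    compared by advancing labellings. *)
Lemma window_split N m i (W : seq 'I_N) : (i + m.+2 <= size W)%N ->
  exists x t y, [/\ size t = m, window m.+2 i W = x :: rcons t y,
    window m.+1 i W = x :: t & window m.+1 i.+1 W = rcons t y].
Proof.
move=> le_i; rewrite /window -[i.+1]add1n -drop_drop drop1.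
have : (m.+2 <= size (drop i W))%N by rewrite size_drop; lia.
case: (drop i W) => [|x s] //=; rewrite ltnS => le_m.
exists x, (take m s), (nth x s m); rewrite -take_nth // size_takel //; lia.
Qed.

(** * From colourings to labellings *)

Section ColoringLabels.
Variables (m n N : nat) (c : edge m.+2 N -> 'I_2).

(** The default colour only concerns sequences that are not increasing
    (m+2)-tuples. *)
Definition color (s : seq 'I_N) : 'I_2 :=
  if insub [set x in s] is Some e then c e else ord0.

(** Whether v ends a path of l edges of colour a.  The path is traced backwards,
    one vertex at a time: belast x v is the predecessor of v along the edge
    x :: v. *)
Fixpoint path_into (a : 'I_2) (l : nat) (v : seq 'I_N) : bool :=
  if l is l'.+1 then
    [exists x, [&& increasing (x :: v), color (x :: v) == a &
      path_into a l' (belast x v)]]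
  else true.

Definition has_mono_path_in (L : nat) : Prop :=
  exists p : 'I_L -> edge m.+2 N,
    monotone_path p /\ exists a : 'I_2, forall i, c (p i) = a.

Lemma path_into_windows a l v : size v = m.+1 -> increasing v ->
  path_into a l v ->
  exists w, [/\ size w = l, increasing (w ++ v) &
    forall i, (i < l)%N -> color (window m.+2 i (w ++ v)) = a].
Proof.
elim: l v => [|l IHl] v size_v inc_v; first by exists [::].
case/existsP=> x /and3P[inc_xv /eqP col_xv].
case/lastP: v size_v inc_v inc_xv col_xv => [//|t y].
rewrite size_rcons belast_rcons => -[size_t] inc_v inc_xv col_xv into.
have inc_xt : increasing (x :: t).
  by move: inc_xv; rewrite /increasing /= rcons_path => /andP[].
have [w [size_w inc_w col_w]] := IHl (x :: t) (congr1 S size_t) inc_xt into.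
have eqW : rcons w x ++ rcons t y = (w ++ x :: t) ++ [:: y].
  by rewrite cat_rcons -cats1 -catA.
exists (rcons w x); split; rewrite ?size_rcons ?size_w //.
  rewrite cat_rcons; move: inc_w inc_xv; rewrite /increasing.
  by case: (w) => [//|z w1] /=; rewrite !cat_path /= => /and3P[-> -> _] ->.
move=> i; rewrite ltnS leq_eqVlt => /predU1P[->|lt_i].
  rewrite cat_rcons /window -size_w drop_size_cat // take_oversize //=.
  by rewrite size_rcons size_t.
by rewrite eqW window_catl ?col_w // size_cat /= size_w size_t; lia.
Qed.

Lemma windows_mono_path a (W : seq 'I_N) :
  size W = (n + m.+2 - 1)%N -> increasing W ->
  (forall i, (i < n)%N -> color (window m.+2 i W) = a) ->
  has_mono_path_in n.
Proof.
move=> size_W inc_W col_W.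
have card_w (i : 'I_n) : #|[set x in window m.+2 i W]| == m.+2.
  rewrite cardsE (card_uniqP _); last first.
    exact/increasing_uniq/window_increasing.
  by rewrite size_window // size_W; have := ltn_ord i; lia.
exists (fun i => exist (fun e : {set 'I_N} => #|e| == m.+2) _ (card_w i)).
split; last first.
  exists a => i; rewrite -(col_W i) // /color.
  by rewrite (insubT (fun e : {set 'I_N} => #|e| == m.+2) (card_w i)).
pose W' := tcast size_W (in_tuple W).
have W'E : codom (tnth W') = W by rewrite /codom /image_mem map_tnth_enum val_tcast.
exists (tnth W'); split=> [i j lt_ij|i]; last by rewrite window_codom W'E.
pose x0 := tnth W' i.
rewrite (tnth_nth x0 W' i) (tnth_nth x0 W' j) val_tcast /=.
apply: (sorted_ltn_nth (leT := relpre val ltn)) => //.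
- by move=> x y z; apply: ltn_trans.
- by rewrite inE size_W.
- by rewrite inE size_W.
Qed.

(** The label of a tuple records, for each colour, the length of the longest
    monochromatic path ending there; in the absence of a path of length n, the
    lengths are less than n. *)
Lemma mono_path_or_advancing : (0 < n)%N ->
  has_mono_path_in n \/ has_advancing N m ('I_n * 'I_n)%type.
Proof.
case: n windows_mono_path => [//|n'] mono_path _.
have [/existsP[v /existsP[a /andP[inc_v into]]]|no_path] :=
    boolP [exists v : m.+1.-tuple 'I_N, exists a,
             increasing v && path_into a n'.+1 v].
  left; have [w [size_w inc_w col_w]] := path_into_windows (size_tuple v) inc_v into.
  by apply: mono_path inc_w col_w; rewrite size_cat size_w size_tuple; lia.
right.
have no_into a v : size v = m.+1 -> increasing v -> ~~ path_into a n'.+1 v.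
  move=> size_v inc_v; apply: contra no_path => into; apply/existsP.
  exists (tcast size_v (in_tuple v)); apply/existsP; exists a.
  by rewrite val_tcast inc_v.
(* Length 0 is always attained, so that the maximum is over a nonempty set. *)
pose len a v : 'I_n'.+1 := [arg max_(l > ord0 | path_into a l v) val l].
exists (fun v => (len ord0 v, len ord_max v)) => x t y size_t inc.
have inc_v : increasing (rcons t y) by exact: path_sorted inc.
have size_v : size (rcons t y) = m.+1 by rewrite size_rcons size_t.
have len_lt a : color (x :: rcons t y) = a -> (len a (x :: t) < len a (rcons t y))%N.
  move=> col; rewrite {1}/len; case: arg_maxnP => // l into_l _.
  have into : path_into a l.+1 (rcons t y).
    by apply/existsP; exists x; rewrite inc col eqxx belast_rcons.
  (* l + 1 = n is excluded by the absence of a path of length n *)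
  have lt_l : (l.+1 < n'.+1)%N.
    rewrite ltn_neqAle ltn_ord andbT; apply/eqP => eq_l.
    by have := no_into a _ size_v inc_v; rewrite -eq_l into.
  by rewrite /len; case: arg_maxnP => // r _ /(_ (Ordinal lt_l)); apply.
rewrite leEprod negb_and /= -!ltNge.
have : (color (x :: rcons t y) == ord0) || (color (x :: rcons t y) == ord_max).
  by case: (color _) => -[|[|]].
by case/orP=> /eqP/len_lt; rewrite !ltEord => ->; rewrite ?orbT.
Qed.

End ColoringLabels.

(** * From labellings to colourings *)

(** The edge is red if the first coordinate increases along it; otherwise the
    second one does, because the labelling is advancing. *)
Lemma advancing_avoiding_coloring m n N :
  has_advancing N m ('I_n * 'I_n)%type ->
  exists c : edge m.+2 N -> 'I_2, ~ has_mono_path_in c n.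
Proof.
case=> f advf.
pose coord (a : 'I_2) (v : seq 'I_N) : nat :=
  if a == ord0 then (f v).1 else (f v).2.
pose red s := (coord ord0 (take m.+1 s) < coord ord0 (behead s))%N.
pose c (e : edge m.+2 N) : 'I_2 := if red (enum (val e)) then ord0 else ord_max.
exists c => -[p [[x [inc_x p_x]] [a col_a]]].
set W := codom x in p_x.
have size_W : size W = (n + m.+2 - 1)%N by rewrite size_codom card_ord.
have inc_W : increasing W.
  rewrite /increasing sorted_map; apply: (@sub_sorted _ (relpre val ltn)).
    by move=> i j; apply: inc_x.
  by rewrite -sorted_map val_enum_ord iota_ltn_sorted.
have coord_lt i : (i < n)%N ->
    (coord a (window m.+1 i W) < coord a (window m.+1 i.+1 W))%N.
  move=> lt_i; have le_i : (i + m.+2 <= size W)%N by rewrite size_W; lia.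
  have := col_a (Ordinal lt_i); rewrite /c p_x window_codom.
  have inc_w := window_increasing m.+2 i inc_W.
  rewrite enum_set_increasing //=.
  have [z [t [y [size_t eq_w -> ->]]]] := window_split le_i.
  rewrite eq_w in inc_w *.
  have := advf z t y size_t inc_w.
  rewrite leEprod negb_and -!ltNge !ltEord /red /=.
  rewrite -cats1 takel_cat ?size_t // take_oversize ?size_t // cats1.
  by rewrite /coord /=; case: ifP => [lt1 _ <-|_ /= lt2 <-].
have coord_ge i : (i <= n)%N -> (i <= coord a (window m.+1 i W))%N.
  by elim: i => // i IHi lt_i; apply: leq_ltn_trans (coord_lt i lt_i); apply/IHi/ltnW.
have := coord_ge n (leqnn n); rewrite leqNgt /coord.
by case: ifP; rewrite ltn_ord.
Qed.

(** * The path Ramsey number *)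

Theorem theorem5 (k n : nat) (hk : (2 <= k)%N) (hn : (2 <= n)%N) :
  is_Nk 2 k n (rho k n + 1)%N.
Proof.
case: k hk => [|[|m]] // _.
case: n hn => [//|n] _.
pose p0 : 'I_n.+1 * 'I_n.+1 := (ord0, ord0).
have advE N : has_advancing N m ('I_n.+1 * 'I_n.+1)%type <-> (N <= rho m.+2 n.+1)%N.
  apply: iff_trans (has_advancing_iter _ _ p0) _.
  rewrite /rho /PP !subSS subn0; apply: has_advancing0.
  exact: iter_downset_inhabited.
split=> [c|N path_N].
  by have [//|/advE] := mono_path_or_advancing c (ltn0Sn n); lia.
rewrite addn1 ltnNge; apply/negP => /advE/advancing_avoiding_coloring[c].
by apply; apply: path_N.
Qed.
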